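(* For every $G_\delta$ set $E\subset\mathbb{R}$, there exists a continuous function $f\colon\mathbb{R}\to\mathbb{R}$ such that $L_f^\infty=l_f^\infty=E$.
   Context: A $G_\delta$ set is a countable intersection of open sets. For a continuous function $f\colon\mathbb{R}\to\mathbb{R}$ and $x\in\mathbb{R}$, $$\operatorname{lip} f(x)=\liminf_{r\to 0^+}\ \sup_{|x-y|\le r}\frac{|f(y)-f(x)|}{r},\qquad \operatorname{Lip} f(x)=\limsup_{r\to 0^+}\ \sup_{|x-y|\le r}\frac{|f(y)-f(x)|}{r},$$ with values in $[0,\infty]$; moreover $l_f^\infty=\{x\in \mathbb{R}: \operatorname{lip} f(x)=\infty\}$ and $L_f^\infty=\{x\in \mathbb{R}: \operatorname{Lip} f(x)=\infty\}$. *)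

(* Defs.v *)
From HB Require Import structures.
From mathcomp Require Import all_boot all_order all_algebra.
From mathcomp Require Import all_classical all_reals all_analysis.
From mathcomp Require Import borel_hierarchy.

Set Implicit Arguments.
Unset Strict Implicit.
Unset Printing Implicit Defensive.

Import Order.TTheory GRing.Theory Num.Theory.
Import numFieldNormedType.Exports.

Local Open Scope classical_set_scope.
Local Open Scope ring_scope.

Definition sup_slope (R : realType) (f : R -> R) (x r : R) : \bar R :=
  ereal_sup [set (`|f y - f x| / r)%:E | y in [set y | `|x - y| <= r]].

Definition little_lip (R : realType) (f : R -> R) (x : R) : \bar R :=
  limf_einf (sup_slope f x) 0^'+.

Definition big_lip (R : realType) (f : R -> R) (x : R) : \bar R :=
  limf_esup (sup_slope f x) 0^'+.

Definition little_lip_infty (R : realType) (f : R -> R) : set R :=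
  [set x | little_lip f x = +oo%E].

Definition big_lip_infty (R : realType) (f : R -> R) : set R :=
  [set x | big_lip f x = +oo%E].

(* Main.v *)
Require Import Defs.
From mathcomp Require Import all_boot all_order all_algebra.
From mathcomp Require Import all_classical all_reals all_analysis.
From mathcomp Require Import borel_hierarchy.
From mathcomp Require Import ring lra.

Import Order.TTheory GRing.Theory Num.Theory.
Import numFieldNormedType.Exports.

Local Open Scope classical_set_scope.
Local Open Scope ring_scope.

(** Write [E] as the intersection of decreasing open sets [G n], smaller than
the whole line as long as [E] is, and let [d n x]
be the distance from [x] to the complement of [G n].  The function is a
lacunary series [f = \sum_n a_n * w_n (d n x)], where [w_n t] is a zigzag on
[0, +oo[ with [0 <= w_n t <= t / 2], slopes of order [l_n], and teeth of length
of order [t / l_n] around [t].  The amplitudes [a_n] decrease geometrically and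
the slopes [k_n = a_n * l_n] of the layers increase geometrically.

Off [E], some [d n x] vanishes.  The layers below [n] are Lipschitz, and every
layer [m] from [n] on is at most [a_m * |y - x|] at [y], so that [f] is
Lipschitz at [x] ([layers_lip]).

On [E], every [d n x] is positive, and layer [n] has teeth of length about
[e_n = d n x / l_n] near [x].  At a scale [r <= e_n] layer [n] varies by about
[k_n * r] ([layers_osc]).  The earlier layers have much smaller slopes, and the
later ones vary by little more than [a_(n+1) * d (n+1) x].  If that quantity is
small compared with [k_n * r], then the slope of [f] at scale [r] is of order
[k_n].  If it is not, and [e_(n+1) < r], then the oscillation of layer [n+1] at
the smaller scale [e_(n+1)], which is about [a_(n+1) * d (n+1) x], already
exceeds a fixed fraction of [k_n * r] ([layers_steep]).  The intervals
from [e_(n+1)] to [e_n] cover all small scales, so the lower limit of the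
slopes is infinite too.

What the argument uses of the distances is collected in [depth_functions].
The lower bound needs a direction in which [d n] moves at unit speed from
[x]: towards a nearest point of the complement for a distance.  When [E] is the
whole line there is no complement, and [1 + |x|] serves instead, moving
away from the origin. *)

Set Implicit Arguments.
Unset Strict Implicit.

(** * The distance to the nearest integer *)

Definition dist_int {R : realType} (u : R) : R :=
  `|u - (Num.floor (u + 1 / 2))%:~R|.

Lemma dist_int_bounds (R : realType) (u : R) : 0 <= dist_int u <= 1 / 2.
Proof.
rewrite /dist_int normr_ge0 /=.
have := floor_itv (u + 1 / 2); rewrite intrD => /andP[h1 h2].
rewrite ler_norml; lra.
Qed.

Lemma dist_intE (R : realType) (k : int) (u : R) :
  `|u - k%:~R| <= 1 / 2 -> dist_int u = `|u - k%:~R|.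
Proof.
rewrite ler_norml => /andP[h1 h2]; rewrite /dist_int.
have [h|h] := ltP (u - k%:~R) (1 / 2).
  by rewrite (@floor_def _ _ k) //; rewrite intrD; lra.
(* a half-integer is equally far from its two neighbours *)
have -> : u = k%:~R + 1 / 2 by lra.
rewrite (@floor_def _ _ (k + 1)); last by rewrite !intrD; lra.
have -> : k%:~R + 1 / 2 - (k + 1)%:~R = - (1 / 2) :> R by rewrite intrD; lra.
have -> : k%:~R + 1 / 2 - k%:~R = 1 / 2 :> R by lra.
by rewrite normrN.
Qed.

Lemma dist_int_le (R : realType) (k : int) (u : R) : dist_int u <= `|u - k%:~R|.
Proof.
have [h|h] := leP `|u - k%:~R| (1 / 2); first by rewrite (dist_intE h).
by have := dist_int_bounds u; lra.
Qed.

Lemma dist_int_lip (R : realType) (u v : R) :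
  `|dist_int u - dist_int v| <= `|u - v|.
Proof.
wlog h : u v / dist_int v <= dist_int u.
  move=> H; have [|/ltW] := leP (dist_int v) (dist_int u); first exact: H.
  by rewrite distrC (distrC u); exact: H.
rewrite ger0_norm ?subr_ge0 // lerBlDr.
apply: le_trans (dist_int_le (Num.floor (v + 1 / 2)) u) _.
by rewrite -(subrKA v); exact: ler_normD.
Qed.

Lemma dist_intN (R : realType) (u : R) : dist_int (- u) = dist_int u.
Proof.
have nb (v : R) : dist_int (- v) <= dist_int v.
  have := dist_int_le (- Num.floor (v + 1 / 2)) (- v).
  by rewrite mulrNz -opprD normrN.
by apply/eqP; rewrite eq_le nb -{1}(opprK u) nb.
Qed.

(** At every point, and at every scale up to 1/4, the zigzag varies by a fixed
fraction of the scale, on one chosen side: corners are sparse, so they cannot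
cancel the unit slope.  A smooth wave such as the sine fails this at its extrema. *)
Lemma dist_int_oscr (R : realType) (u h : R) : 0 <= h <= 1 / 4 ->
  exists2 v, 0 <= v <= h & h / 3 <= `|dist_int (u + v) - dist_int u|.
Proof.
move=> /andP[h0 h4].
pose k := Num.floor (u + 1 / 2); pose w : R := u - k%:~R.
have := floor_itv (u + 1 / 2); rewrite intrD -/k => /andP[k1 k2].
have w1 : - (1 / 2) <= w by rewrite /w; lra.
have w2 : w <= 1 / 2 by rewrite /w; lra.
have zlo (x : R) : - (1 / 2) <= x -> x <= 0 -> dist_int (k%:~R + x) = - x.
  by move=> x1 x2; rewrite (@dist_intE _ k) addrAC subrr add0r ler0_norm //; lra.
have zmid (x : R) : 0 <= x -> x <= 1 / 2 -> dist_int (k%:~R + x) = x.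
  by move=> x1 x2; rewrite (@dist_intE _ k) addrAC subrr add0r ger0_norm //; lra.
have zhi (x : R) : 1 / 2 <= x -> x <= 1 -> dist_int (k%:~R + x) = 1 - x.
  move=> x1 x2.
  have e : k%:~R + x - (k + 1)%:~R = x - 1 :> R by rewrite intrD; lra.
  by rewrite (@dist_intE _ (k + 1)) e ler0_norm //; lra.
have -> : u = k%:~R + w by rewrite /w; lra.
have third : 0 <= h / 3 <= h by lra.
have all_h : 0 <= h <= h by lra.
(* a corner in the first third of the interval leaves two thirds beyond it *)
have [a|a] := leP w (- (h / 3)).
  exists (h / 3) => //; rewrite -addrA (zlo (w + h / 3)) ?(zlo w); try lra.
  by rewrite ler_normr; lra.
have [b|b] := leP w 0.
  exists h => //; rewrite -addrA (zmid (w + h)) ?(zlo w); try lra.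
  by rewrite ler_normr; lra.
have [c|c] := leP w (1 / 2 - h / 3).
  exists (h / 3) => //; rewrite -addrA (zmid (w + h / 3)) ?(zmid w); try lra.
  by rewrite ler_normr; lra.
exists h => //; rewrite -addrA (zhi (w + h)) ?(zmid w); try lra.
by rewrite ler_normr; lra.
Qed.

Lemma dist_int_osc (R : realType) (s u h : R) :
    s = 1 \/ s = -1 -> 0 <= h <= 1 / 4 ->
  exists2 v, 0 <= v <= h & h / 3 <= `|dist_int (u + s * v) - dist_int u|.
Proof.
move=> [->|->] hh.
  by have [v] := dist_int_oscr u hh; exists v; rewrite ?mul1r.
have [v v1 v2] := dist_int_oscr (- u) hh; exists v => //.
by rewrite mulN1r -dist_intN opprD opprK -(dist_intN u).
Qed.


(** * Zigzags with teeth proportional to the argument *)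

(** The logarithm makes the teeth near [t] have length of order [t / l]; at
[t = 0] the factor [t] alone gives the value [0]. *)
Definition log_wave {R : realType} (l t : R) : R := t * dist_int (l * ln t).

Lemma log_wave_bounds (R : realType) (l t : R) :
  0 <= t -> 0 <= log_wave l t <= t / 2.
Proof.
move=> t0; have /andP[z1 z2] := dist_int_bounds (l * ln t).
by rewrite /log_wave mulr_ge0 //= ; have := ler_wpM2l t0 z2; lra.
Qed.

(** The factor [t] cancels the derivative [l / t] of [l * ln t], so that the
Lipschitz constant is uniform down to [0]. *)
Lemma log_wave_lip (R : realType) (l t t' : R) : 0 <= l -> 0 <= t -> 0 <= t' ->
  `|log_wave l t' - log_wave l t| <= (l + 1) * `|t' - t|.
Proof.
wlog h : t t' / t <= t'.
  move=> H l0 t0 t'0; have [tt'|/ltW tt'] := leP t t'; first exact: H.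
  by rewrite distrC (distrC t'); apply: H.
move=> l0; rewrite le_eqVlt => /predU1P[<- t'0|t0 t'0].
  have -> : log_wave l 0 = 0 by rewrite /log_wave mul0r.
  rewrite !subr0; have /andP[w0 w1] := log_wave_bounds l t'0.
  rewrite !ger0_norm //; have := mulr_ge0 l0 t'0; lra.
have t'p : 0 < t' by apply: lt_le_trans h.
have -> : log_wave l t' - log_wave l t = (t' - t) * dist_int (l * ln t') +
    t * (dist_int (l * ln t') - dist_int (l * ln t)).
  by rewrite /log_wave; ring.
apply: le_trans (ler_normD _ _) _.
have /andP[z1 z2] := dist_int_bounds (l * ln t').
have tt' : 0 <= t' - t by lra.
rewrite !normrM (ger0_norm tt') (ger0_norm z1) (gtr0_norm t0).
have lnB : 0 <= ln t' - ln t <= t' / t - 1.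
  rewrite subr_ge0 ler_ln ?posrE // h /= -ln_div ?posrE //.
  have -> : t' / t = 1 + (t' / t - 1) by ring.
  apply: le_trans (le_ln1Dx _) _; last by lra.
  by have := divr_gt0 t'p t0; lra.
have zl : t * `|dist_int (l * ln t') - dist_int (l * ln t)| <= l * (t' - t).
  apply: (@le_trans _ _ (t * (l * (t' / t - 1)))); last first.
    by have -> : t * (l * (t' / t - 1)) = l * (t' - t) by field; rewrite gt_eqF.
  apply: (ler_wpM2l (ltW t0)); apply: le_trans (dist_int_lip _ _) _.
  rewrite -mulrBr normrM (ger0_norm l0); apply: (ler_wpM2l l0).
  by rewrite ger0_norm; case/andP: lnB.
by have := ler_wpM2l tt' z2; lra.
Qed.

Lemma expR_sub1_le (R : realType) (a : R) : `|a| <= 1 / 2 ->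
  `|expR a - 1| <= 2 * `|a|.
Proof.
move=> a2; have /ler_normlP[a3 a4] := a2.
have e1 := expR_ge1Dx a; have e2 := expR_ge1Dx (- a).
rewrite expRN in e2; have ep := expR_gt0 a.
have e3 : (1 - a) * expR a <= 1.
  by rewrite -ler_pdivlMr // mul1r.
rewrite ler_norml; apply/andP; split.
  by have := ler_norm (- a); rewrite normrN; have := normr_ge0 a; lra.
have [a0|a0] := leP 0 a.
  by rewrite ger0_norm //; nra.
by have := normr_ge0 a; nra.
Qed.

(** In the variable [l * ln t], a step of length [r] from [t] has length about
[l * r / t]; the zigzag varies there by a fixed fraction of that length, and the
factor [t] turns this into a multiple of [l * r].  The variation of the factor
itself costs at most [r / 2], which [l >= 24] makes smaller. *)
Lemma log_wave_osc (R : realType) (l t r s : R) :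
    24 <= l -> 0 < t -> 0 <= r <= t / (2 * l) -> s = 1 \/ s = -1 ->
  exists2 q, 0 <= q <= r &
    l * r / 16 <= `|log_wave l (t + s * q) - log_wave l t|.
Proof.
move=> l24 t0 /andP[r0 rle] s1.
have l0 : 0 < l by lra.
have hh : 0 <= l * r / (2 * t) <= 1 / 4.
  rewrite divr_ge0 /=; [|by apply: mulr_ge0; lra|by lra].
  rewrite ler_pdivrMr ?mulr_gt0 //.
  have := ler_wpM2l (ltW l0) rle.
  have -> : l * (t / (2 * l)) = t / 2 by field; rewrite gt_eqF.
  by lra.
have [v /andP[v0 vh] vosc] := dist_int_osc (l * ln t) s1 hh.
have ss : `|s| = 1 by case: s1 => ->; rewrite ?normrN normr1.
have s2 : s * s = 1 by case: s1 => ->; lra.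
pose a := s * v / l; pose t' := t * expR a.
have na : `|a| = v / l.
  by rewrite /a !normrM ss mul1r normfV (ger0_norm v0) (gtr0_norm l0).
have val : v / l <= r / (2 * t).
  rewrite ler_pdivrMr //; apply: le_trans vh _.
  by rewrite le_eqVlt; apply/orP; left; apply/eqP; ring.
have r2t : r / (2 * t) <= 1 / (4 * l).
  rewrite ler_pdivrMr ?mulr_gt0 //; apply: le_trans rle _.
  by rewrite le_eqVlt; apply/orP; left; apply/eqP; field; rewrite gt_eqF.
have a2 : `|a| <= 1 / 2.
  rewrite na; apply: le_trans val _; apply: le_trans r2t _.
  by rewrite ler_pdivrMr ?mulr_gt0 //; lra.
have t'B : `|t' - t| <= r.
  have -> : t' - t = t * (expR a - 1) by rewrite /t'; ring.
  rewrite normrM (gtr0_norm t0).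
  apply: (@le_trans _ _ (t * (2 * (r / (2 * t))))); last first.
    rewrite le_eqVlt; apply/orP; left; apply/eqP; field; rewrite gt_eqF //.
  apply: (ler_wpM2l (ltW t0)); apply: le_trans (expR_sub1_le a2) _.
  by rewrite na; lra.
have t'2 : t / 2 <= t'.
  have := expR_ge1Dx a; have /ler_normlP[a3 a4] := a2 => e.
  have h : 1 / 2 <= expR a by lra.
  by have := ler_wpM2l (ltW t0) h; rewrite -/t'; lra.
have sgn : 0 <= s * (t' - t).
  rewrite /t'; have -> : s * (t * expR a - t) = t * (s * (expR a - 1)) by ring.
  apply: mulr_ge0; first exact: ltW.
  have vl : 0 <= v / l by rewrite divr_ge0 // ltW.
  rewrite /a; case: s1 => ->.
    by rewrite !mul1r; have := expR_ge1Dx (v / l); lra.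
  by rewrite mulN1r mulN1r opprB subr_ge0 mulNr -(expR0 R) ler_expR; lra.
exists (s * (t' - t)).
  rewrite sgn /= -[leLHS]ger0_norm // normrM ss mul1r; exact: t'B.
rewrite mulrA s2 mul1r (addrC t) subrK.
have -> : log_wave l t' - log_wave l t =
    t' * (dist_int (l * ln t + s * v) - dist_int (l * ln t)) +
    (t' - t) * dist_int (l * ln t).
  rewrite /log_wave; have -> : ln t' = ln t + a.
    by rewrite /t' lnM ?posrE ?expR_gt0 // expRK.
  have -> : l * (ln t + a) = l * ln t + s * v.
    by rewrite /a; field; rewrite gt_eqF.
  by ring.
set A := t' * _; set C := (t' - t) * _.
have tp : 0 <= t' by lra.
have hA : l * r / 12 <= `|A|.
  rewrite /A normrM (ger0_norm tp).
  apply: (@le_trans _ _ (t / 2 * (l * r / (2 * t) / 3))).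
    by rewrite le_eqVlt; apply/orP; left; apply/eqP; field; rewrite gt_eqF.
  apply: ler_pM => //; first by lra.
  by case/andP: hh => *; lra.
have hC : `|C| <= r / 2.
  have /andP[z1 z2] := dist_int_bounds (l * ln t).
  rewrite /C normrM (ger0_norm z1).
  by apply: le_trans (ler_pM _ _ t'B z2) _ => //; lra.
have := lerB_normD A C; have := ler_wpM2r r0 l24; lra.
Qed.

(** * The parameters of the layers *)

(** The ratio 1024 lets each layer dominate the sum of the slopes of the
previous ones ([head_lip]) and of the amplitudes of the next ones.
The lock keeps the numeral from being unfolded to a sum
of ones. *)
Definition base {R : realType} : R := locked 1024%:R.
Definition amp {R : realType} (n : nat) : R := base^-1 ^+ n.
Definition steepness {R : realType} (n : nat) : R := base ^+ n.+1.
Definition freq {R : realType} (n : nat) : R := steepness n / amp n.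

Lemma baseE (R : realType) : base = 1024%:R :> R.
Proof. by rewrite /base -lock. Qed.

Lemma base_ge1 (R : realType) : 1 <= base :> R.
Proof. by rewrite baseE ler1n. Qed.

Lemma base_gt0 (R : realType) : 0 < base :> R.
Proof. exact: lt_le_trans ltr01 (base_ge1 R). Qed.

Lemma amp_gt0 (R : realType) n : 0 < amp n :> R.
Proof. by rewrite /amp exprn_gt0 // invr_gt0 base_gt0. Qed.

Lemma ampS (R : realType) n : amp n = base * amp n.+1 :> R.
Proof. by rewrite /amp exprS mulrA divff ?mul1r // gt_eqF // base_gt0. Qed.

Lemma amp_le1 (R : realType) n : amp n <= 1 :> R.
Proof.
rewrite /amp exprn_ile1 ?invr_ge0 ?invf_le1 ?base_ge1 ?base_gt0 //.
exact: ltW (base_gt0 R).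
Qed.

Lemma steepnessS (R : realType) n : steepness n.+1 = base * steepness n :> R.
Proof. by rewrite /steepness exprS. Qed.

Lemma steepness_ge (R : realType) n : base <= steepness n :> R.
Proof.
by rewrite /steepness exprS ler_peMr ?exprn_ege1 ?base_ge1 // ltW // base_gt0.
Qed.

Lemma steepness_gt0 (R : realType) n : 0 < steepness n :> R.
Proof. exact: lt_le_trans (base_gt0 R) (steepness_ge R n). Qed.

Lemma steepness_unbounded (R : realType) n : n.+1%:R <= steepness n :> R.
Proof.
elim: n => [|n ih]; first by rewrite /steepness expr1 base_ge1.
rewrite steepnessS -natr1.
by have := steepness_ge R n; rewrite baseE; lra.
Qed.

Lemma steepness_homo (R : realType) n m :
  (n <= m)%N -> steepness n <= steepness m :> R.
Proof. by move=> nm; rewrite /steepness ler_weXn2l ?ltnS // base_ge1. Qed.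

Lemma amp_freq (R : realType) n : amp n * freq n = steepness n :> R.
Proof. by rewrite /freq mulrCA divff ?mulr1 // gt_eqF // amp_gt0. Qed.

Lemma freq_ge (R : realType) n : steepness n <= freq n :> R.
Proof.
rewrite /freq ler_pdivlMr ?amp_gt0 // ler_piMr ?amp_le1 //.
exact: ltW (steepness_gt0 R n).
Qed.

Lemma freq_ge24 (R : realType) n : 24 <= freq n :> R.
Proof.
apply: le_trans (freq_ge R n).
by have := steepness_ge R n; rewrite baseE; lra.
Qed.

Lemma sum_amp (R : realType) n N : (n <= N)%N ->
  \sum_(n <= m < N) amp m <= 2 * amp n :> R.
Proof.
move=> nN; suff : \sum_(n <= m < N) amp m <= 2 * amp n - 2 * amp N :> R.
  by have := amp_gt0 R N; lra.
elim: N nN => [|N ih]; first by rewrite leqn0 => /eqP ->; rewrite big_nil; lra.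
rewrite leq_eqVlt => /predU1P[->|]; first by rewrite big_geq //; lra.
rewrite ltnS => nN; rewrite big_nat_recr //=.
by have := ih nN; have := amp_gt0 R N.+1; rewrite (ampS R N) baseE; lra.
Qed.

(** * Layers over a decreasing family of depth functions *)

(** The last clause is the unit-speed direction: it lets the variation of a
zigzag around [d n x] on the side [s] be carried back to points near [x].  Both
signs occur: distances decrease towards a nearest point, while an everywhere
positive [d n] must increase, because [q] may reach [d n x]. *)
Definition depth_functions {R : realType} (d : nat -> R -> R) : Prop :=
  [/\ forall n x, 0 <= d n x,
      forall n x y, `|d n x - d n y| <= `|x - y|,
      forall n x, d n.+1 x <= d n x
    & forall n x, exists2 s, s = 1 \/ s = -1 &
        forall q, 0 <= q <= d n x ->
          exists2 y, `|y - x| <= q & d n y = d n x + s * q].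

Definition layer {R : realType} (d : nat -> R -> R) (n : nat) (x : R) : R :=
  amp n * log_wave (freq n) (d n x).

Definition layers {R : realType} (d : nat -> R -> R) (x : R) : R :=
  limn (series (fun n => layer d n x)).

Lemma depth_homo (R : realType) (d : nat -> R -> R) x m n :
  depth_functions d -> (m <= n)%N -> d n x <= d m x.
Proof.
case=> _ _ dS _ mn; rewrite -(subnKC mn).
elim: (n - m)%N => [|k ih]; rewrite ?addn0 // addnS.
exact: le_trans (dS _ _) ih.
Qed.

Lemma layer_bounds (R : realType) (d : nat -> R -> R) n x :
  depth_functions d -> 0 <= layer d n x <= amp n * (d n x / 2).
Proof.
case=> d0 _ _ _; have /andP[w0 w1] := log_wave_bounds (freq n) (d0 n x).
have a0 := ltW (amp_gt0 R n).
by rewrite /layer mulr_ge0 //= (ler_wpM2l a0).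
Qed.

Lemma layer_lip (R : realType) (d : nat -> R -> R) n x y : depth_functions d ->
  `|layer d n y - layer d n x| <= 2 * steepness n * `|y - x|.
Proof.
case=> d0 dL _ _; have a0 := ltW (amp_gt0 R n).
have fr24 := freq_ge24 R n.
have fr0 : 0 <= freq n :> R by lra.
rewrite /layer -mulrBr normrM (ger0_norm a0) -amp_freq.
have := log_wave_lip fr0 (d0 n x) (d0 n y).
have h1 : (freq n + 1) * `|d n y - d n x| <= 2 * freq n * `|y - x|.
  by apply: ler_pM; [lra|exact: normr_ge0|lra|exact: dL].
move=> /le_trans/(_ h1) h; have := ler_wpM2l a0 h.
by have -> : amp n * (2 * freq n * `|y - x|) =
  2 * (amp n * freq n) * `|y - x| by ring.
Qed.

Lemma layer_osc (R : realType) (d : nat -> R -> R) n x r : depth_functions d ->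
    0 < d n x -> 0 <= r <= d n x / (2 * freq n) ->
  exists2 y, `|y - x| <= r &
    steepness n * r / 16 <= `|layer d n y - layer d n x|.
Proof.
case=> d0 dL _ dO dp rr; have a0 := ltW (amp_gt0 R n).
have fr24 := freq_ge24 R n.
have [s s1 hs] := dO n x.
have [q /andP[q0 qr] hq] := log_wave_osc fr24 dp rr s1.
have qd : 0 <= q <= d n x.
  rewrite q0 /=; apply: le_trans qr _; case/andP: rr => _ /le_trans; apply.
  by rewrite ler_pdivrMr; nra.
have [y yx dy] := hs q qd; exists y; first exact: le_trans qr.
rewrite /layer -mulrBr normrM (ger0_norm a0) dy.
apply: le_trans (ler_wpM2l a0 hq).
by rewrite -amp_freq !mulrA.
Qed.

(** The slopes of the first [n] layers add up to a small fraction of the slope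
of the next one. *)
Lemma head_lip (R : realType) (d : nat -> R -> R) n x y : depth_functions d ->
  `|series (layer d ^~ y) n - series (layer d ^~ x) n|
    <= steepness n / 64 * `|y - x|.
Proof.
move=> hd; elim: n => [|n ih].
  rewrite /series /= !big_geq // subrr normr0 mulr_ge0 //.
  by have := steepness_gt0 R 0; lra.
rewrite !seriesSr steepnessS baseE /= opprD addrACA.
apply: le_trans (ler_normD _ _) _.
have := layer_lip n x y hd; have := normr_ge0 (y - x).
have := steepness_gt0 R n; nra.
Qed.

(** The later layers are controlled by their size, not by their slope: each is
at most its amplitude times its depth. *)
Lemma tail_le (R : realType) (d : nat -> R -> R) n N x y :
    depth_functions d -> (n <= N)%N ->
  `|\sum_(n <= m < N) layer d m y - \sum_(n <= m < N) layer d m x|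
    <= 2 * amp n * (d n x + `|y - x|).
Proof.
move=> hd nN; rewrite -sumrB; apply: le_trans (ler_norm_sum _ _ _) _.
have [d0 dL _ _] := hd.
have D0 : 0 <= d n x + `|y - x| by rewrite addr_ge0.
apply: (@le_trans _ _ ((\sum_(n <= m < N) amp m) * (d n x + `|y - x|))).
  rewrite mulr_suml; apply: ler_sum_nat => m /andP[nm mN].
  have /andP[x1 x2] := layer_bounds m x hd.
  have /andP[y1 y2] := layer_bounds m y hd.
  have dm := depth_homo x hd nm.
  have := dL m y x; have := ler_norm (d m y - d m x) => l1 l2.
  have a0 := ltW (amp_gt0 R m); have nd := normr_ge0 (y - x).
  have e1 : d m y / 2 <= d n x + `|y - x| by have := d0 n x; lra.
  have e2 : d m x / 2 <= d n x + `|y - x| by have := d0 n x; lra.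
  have f1 := le_trans y2 (ler_wpM2l a0 e1).
  have f2 := le_trans x2 (ler_wpM2l a0 e2).
  by rewrite ler_norml; lra.
exact: ler_wpM2r D0 _ _ (sum_amp _ nN).
Qed.

Lemma series_split (R : realType) (u : R ^nat) n N : (n <= N)%N ->
  series u N = series u n + \sum_(n <= m < N) u m.
Proof. by move=> nN; rewrite /series /= (big_cat_nat (n := n)). Qed.

(** The last term vanishes where [d n x = 0], which gives a Lipschitz bound at
[x]; everywhere it tends to [0] with [n], which gives continuity. *)
Lemma series_lip (R : realType) (d : nat -> R -> R) n N x y :
    depth_functions d -> (n <= N)%N ->
  `|series (layer d ^~ y) N - series (layer d ^~ x) N|
    <= (steepness n + 2) * `|y - x| + 2 * amp n * d n x.
Proof.
move=> hd nN; rewrite !(series_split _ nN) opprD addrACA.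
apply: le_trans (ler_normD _ _) _.
have := tail_le x y hd nN; have := head_lip n x y hd.
have n0 := normr_ge0 (y - x).
have := ler_wpM2r n0 (amp_le1 R n).
have := mulr_ge0 (ltW (steepness_gt0 R n)) n0.
by lra.
Qed.

(** Layer [n] wins against both the head and the part of the tail that is
proportional to [r]; only the depth of layer [n.+1] remains as an error. *)
Lemma series_osc (R : realType) (d : nat -> R -> R) n N x y r :
    depth_functions d -> (n < N)%N -> `|y - x| <= r ->
    steepness n * r / 16 <= `|layer d n y - layer d n x| ->
  steepness n * r / 32 - 2 * amp n.+1 * d n.+1 x
    <= `|series (layer d ^~ y) N - series (layer d ^~ x) N|.
Proof.
move=> hd nN yx osc; rewrite !(series_split _ nN) !seriesSr /=.
have hT := tail_le x y hd nN; have hH := head_lip n x y hd.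
move: hT hH osc.
set P := layer d n y - _; set Q := series _ n - series _ n.
set T := \sum_(_ <= _ < _) _ - _ => hT hH osc.
rewrite [X in `|X|](_ : _ = P + (Q + T)); last by rewrite /P /Q /T /=; ring.
have := lerB_normD P (Q + T); have := ler_normD Q T.
have a1 := amp_le1 R n.+1; have a0 := amp_gt0 R n.+1.
have s0 := steepness_ge R n; rewrite baseE in s0; have n0 := normr_ge0 (y - x).
have hH' : steepness n / 64 * `|y - x| <= steepness n / 64 * r.
  apply: ler_wpM2l => //; apply: divr_ge0 => //.
  exact: ltW (steepness_gt0 R n).
have hT' : amp n.+1 * `|y - x| <= 1 * r by apply: ler_pM => //; exact: ltW.
have hS : 1024 * r <= steepness n * r by apply: ler_wpM2r; lra.
lra.
Qed.

Lemma is_cvg_layers (R : realType) (d : nat -> R -> R) x :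
  depth_functions d -> cvgn (series (layer d ^~ x)).
Proof.
move=> hd; have [d0 _ _ _] := hd.
apply: (@series_le_cvg _ _ (geometric (d 0%N x) base^-1)).
- by move=> n; case/andP: (layer_bounds n x hd).
- by move=> n; rewrite /= mulr_ge0 // exprn_ge0 // invr_ge0 ltW // base_gt0.
- move=> n; case/andP: (layer_bounds n x hd) => _ /le_trans; apply.
  rewrite /= mulrC; apply: ler_wpM2r; first exact: ltW (amp_gt0 R n).
  by have := depth_homo x hd (leq0n n); have := d0 n x; lra.
- apply: is_cvg_geometric_series.
  rewrite ger0_norm ?invr_ge0 ?(ltW (base_gt0 R)) //.
  by rewrite invf_lt1 ?base_gt0 // baseE ltr1n.
Qed.

Lemma cvg_layersB (R : realType) (d : nat -> R -> R) x y : depth_functions d ->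
  (fun N => `|series (layer d ^~ y) N - series (layer d ^~ x) N|) @ \oo -->
    `|layers d y - layers d x|.
Proof.
by move=> hd; apply: cvg_norm; apply: cvgB; exact: is_cvg_layers.
Qed.

Lemma layers_lip (R : realType) (d : nat -> R -> R) n x y :
    depth_functions d ->
  `|layers d y - layers d x| <=
    (steepness n + 2) * `|y - x| + 2 * amp n * d n x.
Proof.
move=> hd; have c := cvg_layersB (x := x) (y := y) hd.
rewrite -(cvg_lim _ c) //; apply: limr_le.
  by apply/cvg_ex; eexists; exact: c.
by exists n => // N /= nN; exact: series_lip.
Qed.

Lemma layers_osc (R : realType) (d : nat -> R -> R) n x r : depth_functions d ->
    0 < d n x -> 0 <= r <= d n x / (2 * freq n) ->
  exists2 y, `|y - x| <= r &
    steepness n * r / 32 - 2 * amp n.+1 * d n.+1 x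
      <= `|layers d y - layers d x|.
Proof.
move=> hd dp rr; have [y yr osc] := layer_osc hd dp rr; exists y => //.
have c := cvg_layersB (x := x) (y := y) hd.
rewrite -(cvg_lim _ c) //; apply: limr_ge.
  by apply/cvg_ex; eexists; exact: c.
by exists n.+1 => // N /= nN; exact: series_osc.
Qed.

(** * Steepness at every small scale *)

(** The length of the teeth of layer [n] near [x], up to a constant; successive
values delimit the range of scales handled by layer [n]. *)
Definition shell {R : realType} (d : nat -> R -> R) (n : nat) (x : R) : R :=
  d n x / (2 * freq n).

(** As long as layer [n] outweighs the later ones it supplies the slope itself.
For smaller [r], a point within the tooth length of layer [n.+1] is
also within [r], and its oscillation there is already large enough. *)
Lemma layers_steep (R : realType) (d : nat -> R -> R) n x r :
    depth_functions d -> (forall m, 0 < d m x) ->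
    shell d n.+1 x < r <= shell d n x ->
  exists2 y, `|x - y| <= r &
    steepness n / 128 ^+ 2 * r <= `|layers d y - layers d x|.
Proof.
move=> hd dp /andP[r1 r2]; have k0 := steepness_gt0 R n.
have sh0 : 0 <= shell d n.+1 x.
  have := freq_ge24 R n.+1 => h.
  by apply: divr_ge0; [exact: ltW|lra].
have r0 : 0 <= r by apply: le_trans sh0 (ltW r1).
have kr0 : 0 <= steepness n * r by apply: mulr_ge0 => //; exact: ltW.
set a := amp n.+1 * d n.+1 x.
(* [2 * a] bounds the error left by the layers after [n] *)
have [big_r|small_r] := leP (128 * a) (steepness n * r).
  have [|y yr osc] := @layers_osc _ d n x r hd (dp n); first by rewrite r0.
  exists y; first by rewrite distrC.
  by apply: le_trans osc; rewrite -[2 * _ * _]mulrA -/a; lra.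
(* at its own tooth length, layer [n.+1] oscillates by a fraction of [a] *)
have [|y yr osc] := @layers_osc _ d n.+1 x (shell d n.+1 x) hd (dp n.+1).
  by rewrite sh0 lexx.
exists y; first by rewrite distrC; apply: le_trans yr (ltW r1).
apply: le_trans osc.
have -> : steepness n.+1 * shell d n.+1 x = a / 2.
  rewrite -amp_freq /shell /a; field; rewrite gt_eqF //.
  by have := freq_ge24 R n.+1; lra.
have aS : 1024 * (amp n.+2 * d n.+2 x) <= a.
  rewrite /a (ampS R n.+1) baseE mulrA; apply: ler_wpM2l.
    by apply: mulr_ge0; [rewrite ler0n|exact: ltW (amp_gt0 _ _)].
  exact: depth_homo.
by rewrite -[2 * _ * _]mulrA; lra.
Qed.

Lemma shell_between (R : realType) (d : nat -> R -> R) N x r :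
    depth_functions d -> 0 < r <= shell d N x ->
  exists2 n, (N <= n)%N & shell d n.+1 x < r <= shell d n x.
Proof.
move=> hd /andP[r0 rN].
have ex : exists m, (N < m)%N && (shell d m x < r).
  pose m := (N + (Num.truncn (d 0 x / r)).+1)%N.
  have Nm : (N < m)%N by rewrite /m addnS ltnS leq_addr.
  exists m; rewrite Nm /=.
  have fm := freq_ge24 R m.
  rewrite /shell ltr_pdivrMr; last by lra.
  apply: le_lt_trans (depth_homo x hd (leq0n m)) _.
  rewrite mulrC -ltr_pdivrMr //.
  apply: lt_le_trans (truncnS_gt (d 0 x / r)) _.
  apply: le_trans (_ : m%:R <= _); first by rewrite ler_nat /m leq_addl.
  have := le_trans (steepness_unbounded R m) (freq_ge R m).
  by rewrite -natr1; lra.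
case: (ex_minnP ex) => [[//|n] /andP[Nn nr] nmin].
exists n => //; rewrite nr /= leNgt; apply/negP => h.
move: Nn; rewrite ltnS leq_eqVlt => /predU1P[e|Nn].
  by move: h; rewrite -e ltNge rN.
by have := nmin n; rewrite Nn h ltnn => /(_ isT).
Qed.

(** * Criteria for infinite and finite slopes *)

Lemma limf_einf_le_esup (T : choiceType) (X : filteredType T) (R : realType)
    (f : X -> \bar R) (F : set (set X)) :
  ProperFilter F -> (limf_einf f F <= limf_esup f F)%E.
Proof.
move=> PF; rewrite limf_einfE limf_esupE.
apply: ge_ereal_sup => _ [V FV <-]; apply: le_ereal_inf_tmp => _ [W FW <-].
have [r [Vr Wr]] := filter_ex (filterI FV FW).
apply: (@le_trans _ _ (f r)); first by apply: ereal_inf_lbound; exists r.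
by apply: ereal_sup_ubound; exists r.
Qed.

Lemma little_lip_le_big (R : realType) (f : R -> R) (x : R) :
  (little_lip f x <= big_lip f x)%E.
Proof. exact: limf_einf_le_esup. Qed.

Lemma little_lip_infty_of_steep (R : realType) (f : R -> R) (x : R) :
    (forall M : R, exists2 e, 0 < e & forall r, 0 < r <= e ->
      exists2 y, `|x - y| <= r & M * r <= `|f y - f x|) ->
  little_lip f x = +oo%E.
Proof.
move=> steep; apply/eqyP => M _; have [e e0 he] := steep M.
rewrite /little_lip limf_einfE.
have FV : (0^'+) [set r : R | 0 < r < e].
  near=> r => /=; apply/andP; split; near: r.
    exact: nbhs_right_gt.
  exact: nbhs_right_lt.
apply: le_trans (ereal_sup_ubound (ex_intro2 _ _ _ FV erefl)).
apply: le_ereal_inf_tmp => _ [r /= /andP[r0 re] <-].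
have [|y xy hy] := he r; first by rewrite r0 ltW.
apply: (@le_trans _ _ (`|f y - f x| / r)%:E).
  by rewrite lee_fin ler_pdivlMr.
by apply: ereal_sup_ubound; exists y.
Unshelve. all: end_near. Qed.

Lemma big_lip_finite (R : realType) (f : R -> R) (x K : R) :
    0 <= K -> (forall y, `|f y - f x| <= K * `|y - x|) ->
  (big_lip f x < +oo)%E.
Proof.
move=> K0 fK; apply: (@le_lt_trans _ _ K%:E); last exact: ltry.
rewrite /big_lip limf_esupE.
have FV : (0^'+) [set r : R | 0 < r] by exact: nbhs_right_gt.
apply: le_trans (ereal_inf_lbound (ex_intro2 _ _ _ FV erefl)) _.
apply: ge_ereal_sup => _ [r /= r0 <-].
apply: ge_ereal_sup => _ [y /= yr <-].
rewrite lee_fin ler_pdivrMr //; apply: le_trans (fK y) _.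
by apply: ler_wpM2l => //; rewrite distrC.
Qed.

(** * The infinity sets of the series *)

Lemma layers_continuous (R : realType) (d : nat -> R -> R) :
  depth_functions d -> continuous (layers d).
Proof.
move=> hd x; have [d0 _ _ _] := hd.
apply/cvgrPdist_le => e e0.
have D0 : 0 < 4 * (d 0 x + 1) by have := d0 0%N x; lra.
have [n an] : exists n, amp n <= e / (4 * (d 0 x + 1)).
  have /cvgrPdist_le/(_ _ (divr_gt0 e0 D0)) [n _ hn] :
      (GRing.exp (base^-1 : R)) @ \oo --> (0 : R).
    apply: cvg_expr; rewrite ger0_norm ?invr_ge0 ?(ltW (base_gt0 R)) //.
    by rewrite invf_lt1 ?base_gt0 // baseE ltr1n.
  exists n; have := hn n (leqnn n); rewrite /= sub0r normrN.
  exact: le_trans (ler_norm _).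
have K0 : 0 < steepness n + 2 :> R by have := steepness_gt0 R n; lra.
near=> y; rewrite distrC; apply: le_trans (layers_lip n x y hd) _.
have h1 : (steepness n + 2) * `|y - x| <= e / 2.
  rewrite mulrC -ler_pdivlMr // distrC; near: y.
  by apply: cvgr_dist_le; [exact: cvg_id|rewrite !divr_gt0].
have h2 : amp n * d n x <= e / 4.
  apply: (@le_trans _ _ (e / (4 * (d 0 x + 1)) * (d 0 x + 1))).
    apply: ler_pM => //; first exact: ltW (amp_gt0 _ _).
    by have := depth_homo x hd (leq0n n); lra.
  rewrite le_eqVlt; apply/orP; left; apply/eqP; field.
  by rewrite gt_eqF //; have := d0 0%N x; lra.
by lra.
Unshelve. all: end_near. Qed.

Lemma layers_little_lip (R : realType) (d : nat -> R -> R) x :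
  depth_functions d -> (forall n, 0 < d n x) -> little_lip (layers d) x = +oo%E.
Proof.
move=> hd dp; apply: little_lip_infty_of_steep => M.
pose N := Num.truncn (M * 128 ^+ 2); exists (shell d N x).
  by apply: divr_gt0 => //; have := freq_ge24 R N; lra.
move=> r /(shell_between hd) [n Nn hr].
have [y yr hy] := layers_steep hd dp hr; exists y => //.
have r0 : 0 <= r.
  apply: le_trans (_ : shell d n.+1 x <= _); last by case/andP: hr => /ltW.
  by apply: divr_ge0; [exact: ltW|have := freq_ge24 R n.+1; lra].
apply: le_trans hy; apply: ler_wpM2r => //.
rewrite ler_pdivlMr; last by lra.
apply: le_trans (ltW (truncnS_gt _)) _.
exact: le_trans (steepness_unbounded R N) (steepness_homo R Nn).
Qed.

Lemma layers_lip_infty (R : realType) (d : nat -> R -> R) :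
    depth_functions d ->
  [/\ continuous (layers d),
      big_lip_infty (layers d) = [set x | forall n, 0 < d n x]
    & little_lip_infty (layers d) = [set x | forall n, 0 < d n x]].
Proof.
move=> hd; have [d0 _ _ _] := hd.
have little x : (forall n, 0 < d n x) -> little_lip (layers d) x = +oo%E.
  exact: layers_little_lip.
have big x : big_lip (layers d) x = +oo%E -> forall n, 0 < d n x.
  move=> bx n; rewrite lt_neqAle d0 andbT eq_sym; apply/negP => /eqP dn0.
  suff : (big_lip (layers d) x < +oo)%E by rewrite bx ltxx.
  apply: (@big_lip_finite _ _ _ (steepness n + 2)).
    by have := steepness_gt0 R n; lra.
  by move=> y; have := layers_lip n x y hd; rewrite dn0 mulr0 addr0.
split; first exact: layers_continuous.
  apply/seteqP; split => x /=; first exact: big.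
  move=> /little lx; have := little_lip_le_big (layers d) x.
  by rewrite lx leye_eq => /eqP.
apply/seteqP; split => x /=; last exact: little.
move=> lx; apply: big; have := little_lip_le_big (layers d) x.
by rewrite lx leye_eq => /eqP.
Qed.

(** * Distances to closed sets as depth functions *)

Lemma exists_nearest (R : realType) (F : set R) (x : R) :
  closed F -> F !=set0 ->
  exists2 c, F c & forall z, F z -> `|x - c| <= `|x - z|.
Proof.
move=> cF [p Fp]; pose e := `|x - p|.
have K0 : (`[x - e, x + e] `&` F) !=set0.
  exists p; split => //; rewrite /= in_itv /=.
  by have := ler_norm (x - p); have := ler_norm (p - x); rewrite (distrC p) -/e; lra.
have dist_cont : {within `[x - e, x + e] `&` F, continuous (fun z => `|x - z|)}.
  apply: continuous_subspaceT => z.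
  by apply: cvg_norm; apply: cvgB; [exact: cvg_cst|exact: cvg_id].
have cK := compact_closedI (@segment_compact _ (x - e) (x + e)) cF.
have [c] := compact_EVT_min K0 cK dist_cont.
rewrite inE => -[_ Fc] cmin; exists c => // z Fz.
have [ze|/ltW ez] := leP `|x - z| e.
  apply: cmin; rewrite inE; split => //; rewrite /= in_itv /=.
  by move: ze; rewrite ler_norml; lra.
apply: le_trans ez; apply: cmin; rewrite inE; split => //.
rewrite /= in_itv /=.
by have := ler_norm (x - p); have := ler_norm (p - x); rewrite (distrC p) -/e; lra.
Qed.

Definition dist_to {R : realType} (F : set R) (x : R) : R :=
  inf [set `|x - z| | z in F].

Lemma dist_to_le (R : realType) (F : set R) (x z : R) :
  F z -> dist_to F x <= `|x - z|.
Proof.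
move=> Fz; apply: ge_inf; last by exists z.
by exists 0 => _ [w _ <-].
Qed.

Lemma dist_to_ge (R : realType) (F : set R) (x m : R) : F !=set0 ->
  (forall z, F z -> m <= `|x - z|) -> m <= dist_to F x.
Proof.
move=> [p Fp] hm; apply: lb_le_inf; first by exists `|x - p|; exists p.
by move=> _ [z Fz <-]; exact: hm.
Qed.

Lemma dist_to_lip (R : realType) (F : set R) (x y : R) : F !=set0 ->
  `|dist_to F x - dist_to F y| <= `|x - y|.
Proof.
move=> F0; suff H a b : dist_to F a <= dist_to F b + `|a - b|.
  by have := H x y; have := H y x; rewrite (distrC y) ler_norml; lra.
rewrite -lerBlDr; apply: dist_to_ge => // z Fz.
have := dist_to_le a Fz; have := ler_normD (a - b) (b - z).
by rewrite addrA subrK; lra.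
Qed.

Lemma dist_to_attained (R : realType) (F : set R) (x : R) :
  closed F -> F !=set0 -> exists2 c, F c & dist_to F x = `|x - c|.
Proof.
move=> cF F0; have [c Fc cmin] := exists_nearest x cF F0; exists c => //.
by apply/eqP; rewrite eq_le dist_to_le //= dist_to_ge.
Qed.

Lemma dist_to_gt0 (R : realType) (F : set R) (x : R) :
  closed F -> F !=set0 -> (0 < dist_to F x) <-> ~ F x.
Proof.
move=> cF F0; split => [d0 Fx|nFx].
  by have := dist_to_le x Fx; rewrite subrr normr0; lra.
have [c Fc ->] := dist_to_attained x cF F0.
by rewrite normr_gt0 subr_eq0; apply/eqP => e; apply: nFx; rewrite e.
Qed.

(** Walking towards a nearest point decreases the distance at unit speed. *)
Lemma dist_to_step (R : realType) (F : set R) (x q : R) :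
    closed F -> F !=set0 -> 0 <= q <= dist_to F x ->
  exists2 y, `|y - x| <= q & dist_to F y = dist_to F x - q.
Proof.
move=> cF F0; have [c Fc dE] := dist_to_attained x cF F0.
move=> /andP[q0 qd].
pose y := if c <= x then x - q else x + q.
have yx : `|y - x| <= q.
  by rewrite /y; case: ifP => _; rewrite ler_norml; lra.
have yc : `|y - c| = `|x - c| - q.
  move: qd; rewrite dE /y; have [cx|xc] := leP c x => qd.
    rewrite (ger0_norm (x := x - c)) in qd *; last by lra.
    by rewrite ger0_norm; lra.
  rewrite (ler0_norm (x := x - c)) in qd *; last by lra.
  by rewrite ler0_norm; lra.
exists y => //; apply/eqP; rewrite eq_le; apply/andP; split.
  by rewrite dE -yc dist_to_le.
have := dist_to_lip x y F0; have := ler_norm (dist_to F x - dist_to F y).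
by rewrite (distrC x); lra.
Qed.

Lemma depth_dist_to (R : realType) (F : nat -> set R) :
    (forall n, closed (F n)) -> (forall n, F n !=set0) ->
    (forall n, F n `<=` F n.+1) ->
  depth_functions (fun n => dist_to (F n)).
Proof.
move=> cF F0 FS; split => [n x|n x y|n x|n x].
- by apply: dist_to_ge.
- exact: dist_to_lip.
- by apply: dist_to_ge => // z Fz; apply: dist_to_le; exact: FS.
- exists (-1); first by right.
  by move=> q /(dist_to_step (cF n) (F0 n)); rewrite mulN1r.
Qed.

(** Moving away from the origin keeps unit speed at every point, even at the
minimum [0], where both directions lead away. *)
Lemma depth_setT (R : realType) :
  depth_functions (fun (_ : nat) (x : R) => 1 + `|x|).
Proof.
split => [n x|n x y|n x|n x] //.
- by rewrite opprD addrACA subrr add0r; exact: ler_dist_dist.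
exists 1; first by left.
move=> q /andP[q0 _]; rewrite mul1r.
have [x0|x0] := leP 0 x.
  exists (x + q); first by rewrite addrAC subrr add0r ger0_norm.
  by rewrite !ger0_norm ?addr_ge0 // addrA.
exists (x - q); first by rewrite addrAC subrr add0r normrN ger0_norm.
by rewrite !ler0_norm; lra.
Qed.

Unset Implicit Arguments.
Set Strict Implicit.

(** * Gdelta sets as infinity sets *)

Theorem theorem3p35 (R : realType) (E : set R) (hE : Gdelta E) :
  exists f : R -> R,
    [/\ continuous f, big_lip_infty f = E & little_lip_infty f = E].
Proof.
have [->|ET] := pselect (E = setT).
  have all_pos : [set x : R | forall n : nat, 0 < 1 + `|x|] = setT.
    by apply/seteqP; split => x //= _ _; have := normr_ge0 x; lra.
  have := layers_lip_infty (depth_setT R); rewrite all_pos.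
  by exists (layers (fun _ x => 1 + `|x|)).
have [p nEp] : exists p, ~ E p.
  by apply: contrapT => nE; apply: ET; apply/seteqP; split => x // _;
     apply: contrapT => nx; apply: nE; exists x.
have [G oG EG] := hE.
(* the extra point keeps the closed sets nonempty; it lies off [E] *)
pose F n := [set p] `|` \bigcup_(i in `I_n.+1) ~` G i.
have cF n : closed (F n).
  apply: closedU; first exact: closed_eq.
  by apply: closed_bigcup => // i _; exact: open_closedC.
have F0 n : F n !=set0 by exists p; left.
have FS n : F n `<=` F n.+1.
  move=> x [|[i /= iN nG]]; first by left.
  by right; exists i => //=; exact: ltnW.
exists (layers (fun n => dist_to (F n))).
have -> : E = [set x | forall n, 0 < dist_to (F n) x].
  rewrite EG; apply/seteqP; split => x /= Ex.
    move=> n; apply/(dist_to_gt0 x (cF n) (F0 n)) => -[xp|[i _ nG]].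
      by apply: nEp; rewrite EG -xp.
    by apply: nG; exact: Ex.
  move=> n _; apply: contrapT => nG.
  have /(dist_to_gt0 x (cF n) (F0 n)) := Ex n; apply.
  by right; exists n => //=.
exact: layers_lip_infty (depth_dist_to cF F0 FS).
Qed.
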